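(* Let $N\ge 3$ and let $\mathcal{X}\in\mathbb{R}^{I_1\times I_2\times\cdots\times I_N}$ be a nonzero tensor with $\mathrm{MtpRank}(\mathcal{X})=(r_1,r_2,\dots,r_N)$. Then $$\max\{r_1,r_2,\dots,r_N\}\le\mathrm{CPRank}(\mathcal{X})\le r_1r_2\cdots r_N.$$
   Context: $\mathrm{CPRank}(\mathcal{X})$ is the smallest integer $r$ such that there are matrices $\mathbf{A}_n\in\mathbb{R}^{I_n\times r}$, $n=1,\dots,N$, with $\mathcal{X}_{i_1\dots i_N}=\sum_{p=1}^{r}(\mathbf{A}_1)_{i_1p}(\mathbf{A}_2)_{i_2p}\cdots(\mathbf{A}_N)_{i_Np}$ for all indices. Multiple product: for positive integers $r_1,\dots,r_N$ and $N$-order real tensors $\mathcal{A}_n$ of size $r_1\times\cdots\times r_{n-1}\times I_n\times r_{n+1}\times\cdots\times r_N$ ($n=1,\dots,N$), the tensor $[\mathcal{A}_1\mathcal{A}_2\cdots\mathcal{A}_N]\in\mathbb{R}^{I_1\times\cdots\times I_N}$ is defined by $$[\mathcal{A}_1\cdots\mathcal{A}_N]_{i_1\dots i_N}=\sum_{p_1=1}^{r_1}\cdots\sum_{p_N=1}^{r_N}(\mathcal{A}_1)_{i_1p_2\dots p_N}(\mathcal{A}_2)_{p_1i_2p_3\dots p_N}\cdots(\mathcal{A}_N)_{p_1\dots p_{N-1}i_N},$$ where $\mathcal{A}_n$ carries $i_n$ in position $n$ and $p_m$ in each position $m\neq n$. A vector $(r_1,\dots,r_N)$ of positive integers is called admissible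 for $\mathcal{X}\in\mathbb{R}^{I_1\times\cdots\times I_N}$ if $\mathcal{X}=[\mathcal{A}_1\cdots\mathcal{A}_N]$ for some real factor tensors $\mathcal{A}_n\in\mathbb{R}^{r_1\times\cdots\times r_{n-1}\times I_n\times r_{n+1}\times\cdots\times r_N}$, $n=1,\dots,N$. $\mathrm{GTriRank}(\mathcal{X})$ (generalized triple rank), for nonzero $\mathcal{X}$, is the smallest positive integer $r$ such that $(r,r,\dots,r)$ is admissible for $\mathcal{X}$ (such $r$ always exists when $N\geq 3$). $\mathrm{MtpRank}(\mathcal{X})$ (Multiple rank), for nonzero $\mathcal{X}$, is the vector $\mathbf{r}=(r_1,\dots,r_N)$ that is admissible, satisfies $r_i\le\mathrm{GTriRank}(\mathcal{X})$ for all $i$, and has the smallest $\ell_1$ norm $r_1+\cdots+r_N$ among all such vectors; among several vectors with the same minimal $\ell_1$ norm, the lexicographically smallest one is taken. *)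

(* Defs.v *)
From mathcomp Require Import all_boot all_order all_algebra.
From mathcomp Require Import boolp classical_sets reals.

Set Implicit Arguments.
Unset Strict Implicit.
Unset Printing Implicit Defensive.

Import Order.TTheory GRing.Theory Num.Theory.

Local Open Scope ring_scope.

(* All indices are 0-based: mode n ranges over 'I_N, and the n-th coordinate
   of a multi-index of size d ranges over 'I_(d n). *)
Definition multi_index (N : nat) (d : 'I_N -> nat) : finType :=
  {dffun forall n : 'I_N, 'I_(d n)}.

Definition tensor (R : realType) (N : nat) (d : 'I_N -> nat) : zmodType :=
  {ffun multi_index d -> R}.

(* The least element of P, and 0 when P is empty. *)
Definition least (P : nat -> Prop) : nat :=
  xget 0%N [set n | P n /\ forall m, P m -> (n <= m)%N].

Section Ranks.
Variables (R : realType) (N : nat).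
Implicit Types (I : 'I_N -> nat) (r : N.-tuple nat).

Definition has_CP_decomposition I (X : tensor R I) (k : nat) : Prop :=
  exists A : forall n : 'I_N, 'M[R]_(I n, k),
    forall i : multi_index I, X i = \sum_(p < k) \prod_(n < N) A n (i n) p.

Definition CPRank I (X : tensor R I) : nat := least (has_CP_decomposition X).

Definition factor_size I r (n : 'I_N) : 'I_N -> nat :=
  fun m => if m == n then I m else tnth r m.

(* (p_1, ..., p_(n-1), i_n, p_(n+1), ..., p_N) *)
Definition factor_index I r (i : multi_index I) (p : multi_index (tnth r))
    (n : 'I_N) : multi_index (factor_size I r n) :=
  [ffun m => if m == n as b return 'I_(if b then I m else tnth r m)
             then i m else p m].

(* The N-fold sum over p_1, ..., p_N is a single sum over the multi-index p. *)
Definition multiple_product I r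
    (A : forall n : 'I_N, tensor R (factor_size I r n)) : tensor R I :=
  [ffun i : multi_index I =>
     \sum_(p : multi_index (tnth r)) \prod_(n < N) A n (factor_index i p n)].

Definition admissible I (X : tensor R I) r : Prop :=
  (forall n, (0 < tnth r n)%N) /\
  exists A : forall n : 'I_N, tensor R (factor_size I r n),
    X = multiple_product A.

Definition GTriRank I (X : tensor R I) : nat :=
  least (fun k => (0 < k)%N /\ admissible X [tuple k | _ < N]).

Definition Mtp_candidate I (X : tensor R I) r : Prop :=
  admissible X r /\ forall n, (tnth r n <= GTriRank X)%N.

Definition l1_norm r : nat := (\sum_(n < N) tnth r n)%N.

Definition l1_minimal_candidate I (X : tensor R I) r : Prop :=
  Mtp_candidate X r /\
  forall s, Mtp_candidate X s -> (l1_norm r <= l1_norm s)%N.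

(* The lexicographically smallest candidate of minimal l1 norm, and the zero
   vector when there is no candidate. *)
Definition MtpRank I (X : tensor R I) : N.-tuple nat :=
  xget [tuple 0%N | _ < N]
    [set r : N.-tuple nat | l1_minimal_candidate X r /\
       forall s, l1_minimal_candidate X s ->
         ((r : N.-tuplelexi nat) <= (s : N.-tuplelexi nat))%O].

End Ranks.

(* Main.v *)
Require Import Defs.
From mathcomp Require Import all_boot all_order all_algebra.
From mathcomp Require Import boolp classical_sets reals.

(** Both bounds come from converting one kind of decomposition into the other.

    A multiple product is already a sum of products over the multi-index
    [p = (p_1, ..., p_N)], and for a fixed [p] the [n]-th factor depends on the
    tensor index only through [i_n].  It is therefore a CP decomposition with
    one rank-one term per [p], that is with [r_1 * ... * r_N] terms
    ([admissible_CP]); since the multiple rank is admissible, the upper bound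
    follows.

    Conversely, a CP decomposition with [k > 0] terms is a multiple product of
    size [(k, ..., k)]: the [n]-th factor carries the [n]-th CP matrix on the
    diagonal of the summation modes other than [n], and zero elsewhere.  When
    [N >= 3] any two modes avoid a third one, whose factor forces the two
    summation indices to agree, so only the diagonal terms
    [p = (c, ..., c)] survive ([CP_admissible]).  Hence the generalized triple
    rank is at most the CP rank, and every entry of the multiple rank is at most
    the generalized triple rank by definition.

    The ranks are defined by choice with a default value, so one also has to
    see that the minima exist.  Every tensor is a sum of multiples of unit
    tensors, which gives a CP decomposition; it yields an admissible constant
    vector, hence a candidate for the multiple rank, and the candidates lie in a
    finite box. *)

Set Implicit Arguments.
Unset Strict Implicit.
Unset Printing Implicit Defensive.

Import Order.TTheory GRing.Theory.

Local Open Scope ring_scope.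

Lemma leastP (P : nat -> Prop) :
  (exists n, P n) -> P (least P) /\ forall m, P m -> (least P <= m)%N.
Proof.
move=> exP; rewrite /least; case: xgetP => [n _ //|none].
have exPb : exists n, `[< P n >] by case: exP => n Pn; exists n; apply/asboolP.
case: (ex_minnP exPb) => n /asboolP Pn minn; case: (none n).
by split=> // m Pm; apply: minn; apply/asboolP.
Qed.

(** The bound places the tuples in a finite type, on which a linear order
    attains its minimum. *)
Lemma exists_lexi_min (N b : nat) (P : N.-tuple nat -> Prop) :
    (exists r, P r) -> (forall r n, P r -> (tnth r n <= b)%N) ->
  exists r, P r /\
    forall s, P s -> ((r : N.-tuplelexi nat) <= (s : N.-tuplelexi nat))%O.
Proof.
move=> [r0 Pr0] bP.
pose un (f : {ffun 'I_N -> 'I_b.+1}) : N.-tuplelexi nat := [tuple val (f n) | n < N].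
pose box (r : N.-tuple nat) : {ffun 'I_N -> 'I_b.+1} := [ffun n => inord (tnth r n)].
have boxK r : P r -> un (box r) = r.
  by move=> Pr; apply: eq_from_tnth => n; rewrite tnth_mktuple ffunE /= inordK ?ltnS ?bP.
have Pf0 : `[< P (un (box r0)) >] by apply/asboolP; rewrite boxK.
case: (@Order.TotalTheory.arg_minP _ _ _ (box r0) (fun f => `[< P (un f) >]) un Pf0).
move=> f /asboolP Pf minf.
exists (un f); split=> // s Ps; rewrite -(boxK _ Ps); apply: minf.
by apply/asboolP; rewrite boxK.
Qed.

Section Decompositions.
Variables (R : realType) (N : nat).
Implicit Types (I : 'I_N -> nat) (r : N.-tuple nat).

Lemma has_CP_fintype I (X : tensor R I) (T : finType)
    (F : forall n : 'I_N, 'I_(I n) -> T -> R) :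
  (forall i, X i = \sum_(t : T) \prod_(n < N) F n (i n) t) ->
  has_CP_decomposition X #|T|.
Proof.
move=> XE; exists (fun n => \matrix_(j, p) F n j (enum_val p)) => i.
rewrite XE (reindex (@enum_val T predT)) /=; last by apply: onW_bij; apply: enum_val_bij.
by apply: eq_bigr => p _; apply: eq_bigr => n _; rewrite mxE.
Qed.

(** Expansion in the unit tensors; the coefficient [X t] is put into the factor
    of mode [n0]. *)
Lemma has_CP_exists I (X : tensor R I) :
  (0 < N)%N -> exists k, has_CP_decomposition X k.
Proof.
move=> N_gt0; pose n0 := Ordinal N_gt0; exists #|multi_index I|.
apply: (@has_CP_fintype _ _ _ (fun n j t =>
  (if n == n0 then X t else 1) * (j == t n)%:R)) => i.
rewrite (bigD1 i) //= [X in _ + X]big1 ?addr0 => [|t ti].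
  rewrite (bigD1 n0) //= !eqxx mulr1 big1 ?mulr1 // => n /negPf ->.
  by rewrite eqxx mulr1.
have [n ne_n] : exists n, i n != t n.
  apply/existsP; apply: contraNT ti => /existsPn eq_it.
  by apply/eqP/ffunP => n; apply/esym/eqP; have := eq_it n; rewrite negbK.
by rewrite (bigD1 n) //= (negPf ne_n) mulr0 mul0r.
Qed.

Lemma has_CP0 I (X : tensor R I) : has_CP_decomposition X 0 -> X = 0.
Proof. by case=> A XE; apply/ffunP => i; rewrite XE big_ord0 ffunE. Qed.

Lemma val_factor_index I r (i : multi_index I) (p : multi_index (tnth r)) n m :
  val (factor_index i p n m) = if m == n then val (i m) else val (p m).
Proof.
(* The dimension depends on the same test as the coordinate, so the case split
   is made after generalizing both. *)
have val_if (a c : nat) (b : bool) (x : 'I_a) (y : 'I_c) :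
    nat_of_ord (if b as b return 'I_(if b then a else c) then x else y)
    = if b then val x else val y by case: b.
by rewrite ffunE; apply: val_if.
Qed.

Lemma factor_index_local I r (i j : multi_index I) (p : multi_index (tnth r)) n :
  i n = j n -> factor_index i p n = factor_index j p n.
Proof.
move=> eq_ij; apply/ffunP => m; apply: val_inj; rewrite !val_factor_index.
by case: eqP => // ->; rewrite eq_ij.
Qed.

(** Each multi-index [p] contributes one rank-one term.  The matrix of mode [n]
    has to be defined from a single coordinate [j]; a fixed multi-index [i0]
    fills in the other coordinates. *)
Lemma admissible_CP I (X : tensor R I) r :
  X != 0 -> admissible X r -> has_CP_decomposition X (\prod_(n < N) tnth r n).
Proof.
move=> X0 [_ [A XE]].
have [i0 _] : exists i0, X i0 != 0.
  apply/existsP; apply: contraNT X0 => /existsPn X0.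
  by apply/eqP/ffunP => i; rewrite [RHS]ffunE; apply/eqP; have := X0 i; rewrite negbK.
have -> : (\prod_(n < N) tnth r n)%N = #|multi_index (tnth r)|.
  by rewrite card_dep_ffun foldrE big_map big_enum; apply: eq_bigr => n _; rewrite card_ord.
apply: (@has_CP_fintype _ _ _ (fun n j p =>
  A n (factor_index [ffun m => dfwith i0 j m] p n))) => i.
rewrite XE ffunE; apply: eq_bigr => p _; apply: eq_bigr => n _.
by congr (A n _); apply: factor_index_local; rewrite ffunE dfwith_in.
Qed.

Lemma factor_size_diag I r n : factor_size I r n n = I n.
Proof. by rewrite /factor_size eqxx. Qed.

Lemma factor_index_diag I r (i : multi_index I) (p : multi_index (tnth r)) n :
  cast_ord (factor_size_diag I r n) (factor_index i p n n) = i n.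
Proof. by apply: val_inj; rewrite /= [LHS]val_factor_index eqxx. Qed.

Lemma ord_avoid2 (m m' : 'I_N) : (3 <= N)%N -> exists n, (m != n) && (m' != n).
Proof.
move=> N3; apply/existsP; apply: contraLR N3 => /existsPn cov.
rewrite -ltnNge ltnS -[N in (N <= _)%N]card_ord.
apply: leq_trans (_ : #|[set m; m']| <= 2)%N; last by rewrite cards2; case: (_ != _).
rewrite -cardsT; apply/subset_leq_card/fintype.subsetP => n _.
by have := cov n; rewrite negb_and !negbK !inE ![_ == n]eq_sym.
Qed.

(** The [n]-th factor [B n] vanishes unless the summation indices of the modes
    other than [n] share one value [c], and then selects column [c] of [A n].
    All [N] factors together leave only the constant summation indices, because
    two modes are always both different from some third one. *)
Lemma CP_admissible I (X : tensor R I) k :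
    (3 <= N)%N -> (0 < k)%N -> has_CP_decomposition X k ->
  admissible X [tuple k | _ < N].
Proof.
move=> N3 k_gt0 [A XE]; set r := [tuple k | _ < N].
have rE n : k = tnth r n by rewrite tnth_mktuple.
split=> [n|]; first by rewrite -rE.
pose diag n (q : multi_index (factor_size I r n)) (c : 'I_k) :=
  [forall m, (m != n) ==> (val (q m) == c :> nat)].
pose B n : tensor R (factor_size I r n) := [ffun q =>
  \sum_(c < k | diag n q c) A n (cast_ord (factor_size_diag I r n) (q n)) c].
exists B; apply/ffunP => i; rewrite XE ffunE.
pose h (c : 'I_k) : multi_index (tnth r) := [ffun n => cast_ord (rE n) c].
have hE c n : val (h c n) = c :> nat by rewrite ffunE.
have diagE (p : multi_index (tnth r)) n c :
    diag n (factor_index i p n) c = [forall m, (m != n) ==> (val (p m) == c :> nat)].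
  apply: eq_forallb => m; case: (boolP (m != n)) => //= mn.
  by rewrite val_factor_index (negPf mn).
have BE c n : B n (factor_index i (h c) n) = A n (i n) c.
  rewrite ffunE (big_pred1 c) ?factor_index_diag // => d; rewrite diagE.
  have [m [/andP[mn _]]] := ord_avoid2 n n N3.
  apply/forallP/eqP => [/(_ m)|-> l]; last by rewrite hE eqxx implybT.
  by rewrite eq_sym mn hE => /eqP ?; apply: val_inj.
have n0 : 'I_N by exists 0%N; apply: leq_trans N3.
pose g (p : multi_index (tnth r)) : 'I_k := cast_ord (esym (rE n0)) (p n0).
have hK : cancel h g by move=> c; apply: val_inj; rewrite /= hE.
rewrite (bigID (fun p => h (g p) == p)) /= [X in _ + X]big1 ?addr0 => [|p np].
  rewrite (reindex_onto h g); last by move=> p /eqP.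
  rewrite [RHS](eq_bigl xpredT) => [|c]; last by rewrite !hK !eqxx.
  by apply: eq_bigr => c _; apply: eq_bigr => n _; rewrite BE.
(* A summation index off the diagonal: some coordinate differs from the one in
   mode [n0], and the factor of a mode avoiding both vanishes. *)
have [m ne_m] : exists m, val (p m) != val (p n0) :> nat.
  apply/existsP; apply: contraNT np => /existsPn eqp; apply/eqP/ffunP => m.
  by apply: val_inj; rewrite /= hE /=; apply/esym/eqP; have := eqp m; rewrite negbK.
have [n /andP[mn n0n]] := ord_avoid2 m n0 N3.
rewrite (bigD1 n) //= ffunE big1 ?mul0r // => c; rewrite diagE => /forallP pc.
have := pc m; have := pc n0; rewrite mn n0n /= => /eqP p0 /eqP pm.
by rewrite /= p0 pm eqxx in ne_m.
Qed.

Lemma CPRankP I (X : tensor R I) :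
  (0 < N)%N -> has_CP_decomposition X (CPRank X).
Proof. by move=> N_gt0; have [] := leastP (has_CP_exists X N_gt0). Qed.

Lemma CPRank_le I (X : tensor R I) k :
  has_CP_decomposition X k -> (CPRank X <= k)%N.
Proof. by move=> Xk; have [_ ->] := leastP (ex_intro _ k Xk). Qed.

Lemma CPRank_gt0 I (X : tensor R I) : (0 < N)%N -> X != 0 -> (0 < CPRank X)%N.
Proof.
move=> N_gt0 X0; rewrite lt0n; apply: contra_neqN X0 => /eqP k0.
by apply: has_CP0; rewrite -k0; apply: CPRankP.
Qed.

Lemma GTriRankP I (X : tensor R I) : (3 <= N)%N -> X != 0 ->
  admissible X [tuple GTriRank X | _ < N] /\ (GTriRank X <= CPRank X)%N.
Proof.
move=> N3 X0; have N_gt0 : (0 < N)%N by apply: leq_trans N3.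
pose P k := (0 < k)%N /\ admissible X [tuple k | _ < N].
have cp : P (CPRank X).
  by split; [|apply: CP_admissible (CPRankP X N_gt0) => //]; apply: CPRank_gt0.
by have [[_ ?] /(_ _ cp)] := leastP (ex_intro P _ cp).
Qed.

(** The constant vector of the generalized triple rank is a candidate, so a
    candidate of least norm exists; the candidates are bounded entrywise, so a
    lexicographically least one exists among those. *)
Lemma MtpRank_candidate I (X : tensor R I) : (3 <= N)%N -> X != 0 ->
  Mtp_candidate X (MtpRank X).
Proof.
move=> N3 X0; rewrite /MtpRank; case: xgetP => [r _ [[]] //|none].
have [adm _] := GTriRankP N3 X0.
have exl : exists l, exists r, Mtp_candidate X r /\ l1_norm r = l.
  exists (l1_norm [tuple GTriRank X | _ < N]), [tuple GTriRank X | _ < N].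
  by split=> //; split=> // n; rewrite tnth_mktuple.
have [[r [cr lr]] minl] := leastP exl.
have exr : exists r, l1_minimal_candidate X r.
  by exists r; split=> // s cs; rewrite lr; apply: minl; exists s.
have [|s smin] := exists_lexi_min (b := GTriRank X) exr.
  by move=> s n [[_ ->]].
by case: (none s).
Qed.

End Decompositions.

Theorem theorem3p4 (R : realType) (N : nat) (I : 'I_N -> nat)
    (X : tensor R I) (r : N.-tuple nat)
    (hN : (3 <= N)%N) (hX : X != 0) (hr : MtpRank X = r) :
  (\max_(n < N) tnth r n <= CPRank X)%N /\
  (CPRank X <= \prod_(n < N) tnth r n)%N.
Proof.
have [adm le_r] := MtpRank_candidate hN hX; rewrite hr in adm le_r.
have [_ GC] := GTriRankP hN hX.
split; first by apply/bigmax_leqP => n _; apply: leq_trans GC.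
by apply/CPRank_le/admissible_CP.
Qed.
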